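(* An instance of the asymmetric cardinality-based hypergraph $s$-$t$ cut problem is graph reducible if and only if every one of its (asymmetric, cardinality-based) splitting functions is submodular.
   Context: A hypergraph $\mathcal{H}=(V,E)$ has finite vertex set $V$ and hyperedges that are subsets of $V$. An asymmetric splitting function on a hyperedge $e$ is a function $\mathbf{y}_e:2^e\to\mathbb{R}_{\ge 0}$ with $\mathbf{y}_e(e)=\mathbf{y}_e(\emptyset)=0$ (no symmetry required); it is cardinality-based if $\mathbf{y}_e(S)$ depends only on $|S|$, and submodular if $\mathbf{y}_e(A)+\mathbf{y}_e(B)\ge\mathbf{y}_e(A\cap B)+\mathbf{y}_e(A\cup B)$ for all $A,B\subseteq e$. Given $s,t\in V$, the asymmetric hypergraph $s$-$t$ cut problem minimizes $\sum_{e\in E}\mathbf{y}_e(e\cap S)$ over $S\subseteq V$ with $s\in S$, $t\notin S$ ($S$ is the source side). A hyperedge $s$-$t$ cut gadget on $e$ is a graph $G_e=(V',E')$ with $V'=e\cup\hat V$ ($\hat V$ auxiliary nodes) and possibly directed edges with nonnegative weights $w_{ij}$; its gadget splitting function is $\hat{\mathbf{y}}_e(S)=\min_{T\subseteq V',\,T\cap e=S}\sum_{i\in T}\sum_{j\in V'\setminus T}w_{ij}$ for $S\subseteq e$ (directed edges counted only from $T$ to $V'\setminus T$). The instance is graph reducible if for every hyperedge $e$ there is a gadget with $\hat{\mathbf{y}}_e=\mathbf{y}_e$. *)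

(* Defs.v *)
From mathcomp Require Import all_boot all_order all_algebra.
From mathcomp Require Import reals.

Set Implicit Arguments.
Unset Strict Implicit.
Unset Printing Implicit Defensive.

Import Order.TTheory GRing.Theory Num.Theory.
Local Open Scope ring_scope.

(* Functions on 2^e are functions on {set T}, where T := {x | x \in e} is the
   finite type of the nodes of e; thus set0 and setT stand for the empty set
   and for e itself. *)

Definition asym_splitting (R : realType) (T : finType) (y : {set T} -> R) :=
  [/\ forall S, 0 <= y S, y [set: T] = 0 & y set0 = 0].

Definition cardinality_based (R : realType) (T : finType) (y : {set T} -> R) :=
  forall A B : {set T}, #|A| = #|B| -> y A = y B.

Definition submodular (R : realType) (T : finType) (y : {set T} -> R) :=
  forall A B : {set T}, y (A :&: B) + y (A :|: B) <= y A + y B.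

Record asym_cut_instance (R : realType) := AsymCutInstance {
  vertex : finType;
  hyperedges : {set {set vertex}};
  source : vertex;
  sink : vertex;
  (* only the values splitting_fun e with e \in hyperedges are meaningful *)
  splitting_fun : forall e : {set vertex}, {set {x | x \in e}} -> R;
  splitting_funP : forall e, e \in hyperedges -> asym_splitting (@splitting_fun e)
}.

Definition hyperedge_trace (V : finType) (e S : {set V}) : {set {x | x \in e}} :=
  [set x | val x \in S].

Definition st_cut (R : realType) (I : asym_cut_instance R)
  (S : {set vertex I}) := (source I \in S) && (sink I \notin S).

(* The objective minimized over the sets S with st_cut S. *)
Definition cut_value (R : realType) (I : asym_cut_instance R)
  (S : {set vertex I}) : R :=
  \sum_(e in hyperedges I) splitting_fun (hyperedge_trace e S).

(* Directed weighted graph on the disjoint union of T and of the auxiliary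
   nodes; a missing edge has weight 0 and an undirected edge is a pair of
   opposite edges of equal weight. *)
Record gadget (R : realType) (T : finType) := Gadget {
  aux : finType;
  weight : T + aux -> T + aux -> R;
  weight_ge0 : forall i j, 0 <= weight i j
}.

Definition gadget_cut (R : realType) (T : finType) (G : gadget R T)
  (X : {set T + aux G}) : R :=
  \sum_(i in X) \sum_(j in ~: X) weight i j.

Definition gadget_trace (T U : finType) (X : {set T + U}) : {set T} :=
  [set x | inl x \in X].

(* The default value of the iterated minimum is the cut of a set of trace S
   (S without any auxiliary node), so this is the minimum over the sets of
   trace S; see gadget_splittingP. *)
Definition gadget_splitting (R : realType) (T : finType) (G : gadget R T)
  (S : {set T}) : R :=
  \big[Num.min/gadget_cut (inl @: S : {set T + aux G})]_
    (X : {set T + aux G} | gadget_trace X == S) gadget_cut X.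

Lemma gadget_splittingP (R : realType) (T : finType) (G : gadget R T)
    (S : {set T}) :
  (exists2 X : {set T + aux G},
     gadget_trace X = S & gadget_splitting G S = gadget_cut X) /\
  (forall X : {set T + aux G},
     gadget_trace X = S -> gadget_splitting G S <= gadget_cut X).
Proof.
split; last by move=> X /eqP trX; rewrite /gadget_splitting (bigD1 X)//= ge_min lexx.
rewrite /gadget_splitting; apply: (big_ind (fun r => exists2 X : {set T + aux G},
    gadget_trace X = S & r = gadget_cut X)).
- exists (inl @: S) => //; apply/setP => x.
  by rewrite inE mem_imset // => a b [].
- by move=> a b Ha Hb; rewrite minEle; case: ifP.
- by move=> X /eqP trX; exists X.
Qed.

Definition graph_reducible (R : realType) (I : asym_cut_instance R) :=
  forall e, e \in hyperedges I ->
  exists G : gadget R {x | x \in e}, gadget_splitting G =1 @splitting_fun R I e.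

(* Main.v *)
Require Import Defs.
From mathcomp Require Import all_boot all_order all_algebra.
From mathcomp Require Import reals.
From mathcomp Require Import zify ring lra.

(** Cut functions of nonnegatively weighted digraphs are submodular, and
    submodularity survives the minimization over the auxiliary nodes.
    Conversely, a submodular cardinality-based splitting function on n nodes is
    S |-> f #|S| with f concave on 0..n and f 0 = f n = 0.  Such an f is the
    nonnegative combination, over the breakpoints 0 < k < n, of the hat functions
    i |-> min ((n - k) i) (k (n - i)), with coefficients
    (2 f k - f (k - 1) - f (k + 1)) / n.  The k-th hat is realized by one
    auxiliary node, with an edge of weight n - k from every node of the hyperedge
    and an edge of weight k to every node of the hyperedge, both scaled by the
    coefficient. *)

Set Implicit Arguments.
Unset Strict Implicit.
Unset Printing Implicit Defensive.

Import Order.TTheory GRing.Theory Num.Theory.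
Local Open Scope ring_scope.

Section GadgetSubmodular.
Variables (R : realType) (T : finType) (G : gadget R T).

Lemma gadget_cutE (X : {set T + aux G}) :
  gadget_cut X = \sum_i \sum_j weight i j * ((i \in X) && (j \notin X))%:R.
Proof.
rewrite /gadget_cut big_mkcond; apply: eq_bigr => i _.
case: (i \in X); last by rewrite big1 // => j _; rewrite mulr0.
rewrite big_mkcond; apply: eq_bigr => j _; rewrite in_setC.
by case: (j \notin X); rewrite ?mulr1 ?mulr0.
Qed.

(** Weights are nonnegative, so it suffices to treat one edge: the indicator that it leaves [X] is
    submodular in [X], by the 16 membership cases of its ends. *)
Lemma gadget_cut_submodular : submodular (@gadget_cut R T G).
Proof.
move=> X Y; rewrite !gadget_cutE -!big_split; apply: ler_sum => i _.
rewrite -!big_split; apply: ler_sum => j _; rewrite /= -!mulrDr.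
rewrite ler_wpM2l ?weight_ge0 // !inE -!natrD ler_nat.
by case: (i \in X); case: (i \in Y); case: (j \in X); case: (j \in Y).
Qed.

(** Traces commute with intersection and union, so optimal sets for [A] and [B] yield candidates for
    [A :&: B] and [A :|: B]. *)
Lemma gadget_splitting_submodular : submodular (@gadget_splitting R T G).
Proof.
move=> A B.
have [[X trX ->] _] := gadget_splittingP G A.
have [[Y trY ->] _] := gadget_splittingP G B.
apply: le_trans (gadget_cut_submodular X Y); apply: lerD.
- apply: (gadget_splittingP G _).2.
  by rewrite -trX -trY; apply/setP => x; rewrite !inE.
- apply: (gadget_splittingP G _).2.
  by rewrite -trX -trY; apply/setP => x; rewrite !inE.
Qed.

End GadgetSubmodular.

Section StarGadget.
Variables (R : realType) (T U : finType) (a b : U -> R).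
Hypotheses (a_ge0 : forall k, 0 <= a k) (b_ge0 : forall k, 0 <= b k).

Definition star_weight (i j : T + U) : R :=
  match i, j with
  | inl _, inr k => a k
  | inr k, inl _ => b k
  | _, _ => 0
  end.

Lemma star_weight_ge0 i j : 0 <= star_weight i j.
Proof. by case: i j => [x|k] [y|l] /=. Qed.

Definition star_gadget : gadget R T := Gadget star_weight_ge0.

Lemma star_gadget_cut (X : {set T + aux star_gadget}) :
  gadget_cut X = \sum_(k : U)
    if inr k \in X then b k * #|~: gadget_trace X|%:R
    else a k * #|gadget_trace X|%:R.
Proof.
have sumE (P : pred T) (c : R) : \sum_(x : T) c * (P x)%:R = c * #|P|%:R.
  rewrite -mulr_sumr -sum1_card natr_sum [in RHS]big_mkcond; congr (_ * _).
  by apply: eq_bigr => x _; rewrite unfold_in; case: (P x).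
rewrite gadget_cutE big_sumType /=.
under eq_bigr => x _.
  by rewrite big_sumType /= big1 ?add0r => [|z _]; [over|rewrite mul0r].
under [X in _ + X]eq_bigr => k _.
  by rewrite big_sumType /= [X in _ + X]big1 ?addr0 => [|z _]; [over|rewrite mul0r].
(* Every edge of nonzero weight has exactly one auxiliary end; grouped by that end [k], the side of
   [k] decides which of the two edge directions can be cut. *)
rewrite exchange_big -big_split; apply: eq_bigr => k _ /=.
rewrite (sumE (fun x => (inl x \in X) && (inr k \notin X))).
rewrite (sumE (fun x => (inr k \in X) && (inl x \notin X))).
case: (inr k \in X) => /=.
- rewrite [X in a k * X%:R]eq_card0 ?mulr0 ?add0r; last first.
    by move=> x; rewrite unfold_in andbF.
  by congr (_ * _%:R); apply: eq_card => x; rewrite !inE.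
- rewrite [X in b k * X%:R]eq_card0 ?mulr0 ?addr0 //.
  by congr (_ * _%:R); apply: eq_card => x; rewrite !inE unfold_in andbT.
Qed.

(** Auxiliary nodes are pairwise non-adjacent, so each picks its cheaper side independently and the
    minimum of the sum is the sum of the minima. *)
Lemma star_gadget_splitting (S : {set T}) :
  gadget_splitting star_gadget S =
  \sum_(k : U) Num.min (a k * #|S|%:R) (b k * #|~: S|%:R).
Proof.
apply/le_anti/andP; split.
- pose X : {set T + aux star_gadget} := [set z | match z with
    | inl x => x \in S
    | inr k => b k * #|~: S|%:R < a k * #|S|%:R end].
  have trX : gadget_trace X = S by apply/setP => x; rewrite !inE.
  have := (gadget_splittingP star_gadget S).2 X trX.
  rewrite star_gadget_cut trX => /le_trans; apply; apply: ler_sum => k _.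
  by rewrite inE minC minElt.
- have [[X trX ->] _] := gadget_splittingP star_gadget S.
  rewrite star_gadget_cut trX; apply: ler_sum => k _.
  by case: ifP => _; rewrite ge_min lexx ?orbT.
Qed.

End StarGadget.

Section HatDecomposition.
Variables (R : realType) (n : nat).

Definition hat (k i : nat) : R :=
  Num.min ((n%:R - k%:R) * i%:R) (k%:R * (n%:R - i%:R)).

Lemma hat_le k i : (i <= k)%N -> hat k i = (n%:R - k%:R) * i%:R.
Proof.
rewrite -(ler_nat R) => le_ik; apply/min_idPl; rewrite -subr_ge0.
have -> : k%:R * (n%:R - i%:R) - (n%:R - k%:R) * i%:R
  = n%:R * (k%:R - i%:R) :> R by ring.
by rewrite mulr_ge0 // subr_ge0.
Qed.

Lemma hat_ge k i : (k <= i)%N -> hat k i = k%:R * (n%:R - i%:R).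
Proof.
rewrite -(ler_nat R) => le_ki; apply/min_idPr; rewrite -subr_ge0.
have -> : (n%:R - k%:R) * i%:R - k%:R * (n%:R - i%:R)
  = n%:R * (i%:R - k%:R) :> R by ring.
by rewrite mulr_ge0 // subr_ge0.
Qed.

(** The negated second difference centred at [i.+1], nonnegative where [f] is concave; the shift
    avoids predecessors. *)
Definition diff2 (f : nat -> R) (i : nat) : R := 2 * f i.+1 - f i - f i.+2.

(** The hat is linear on each side of its single kink [k.+1], where the slope drops from [n - k.+1]
    to [- k.+1], hence by [n]. *)
Lemma diff2_hat k i : diff2 (hat k.+1) i = n%:R * (i == k)%:R.
Proof.
rewrite /diff2; case: ltngtP => [lt_ik|lt_ki|->].
- by rewrite !hat_le; [rewrite /= -!natr1; ring|lia..].
- by rewrite !hat_ge; [rewrite /= -!natr1; ring|lia..].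
- rewrite (@hat_le _ k) // (@hat_le _ k.+1) // (@hat_ge _ k.+2) //.
  by rewrite /= -!natr1; ring.
Qed.

Lemma diff2_eq0_eq0 (g : nat -> R) :
    g 0%N = 0 -> g n = 0 -> (forall i, (i.+1 < n)%N -> diff2 g i = 0) ->
  forall i, (i <= n)%N -> g i = 0.
Proof.
move=> g0 gn dg.
(* The recurrence has order two, so the induction carries two consecutive values; [g n = 0] then
   kills the slope [g 1]. *)
have lin i : (i < n)%N -> g i = i%:R * g 1%N /\ g i.+1 = i.+1%:R * g 1%N.
  elim: i => [|i IHi] lt_in; first by rewrite g0 mul0r mul1r.
  have [gi gSi] := IHi (ltnW lt_in); split=> //.
  have := dg _ lt_in; rewrite /diff2 gi gSi -!natr1 => H.
  by apply/eqP; rewrite -subr_eq0 -oppr_eq0; apply/eqP; rewrite -[RHS]H; ring.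
move=> i le_in; have [->//|i_gt0] := posnP i.
have n_gt0 : (0 < n)%N by exact: leq_trans le_in.
have g1 : g 1%N = 0.
  have := (lin n.-1 _).2; rewrite prednK // leqnn gn => /(_ isT)/esym/eqP.
  by rewrite mulf_eq0 pnatr_eq0 (gtn_eqF n_gt0) => /eqP.
have := (lin i.-1 _).2; rewrite prednK // => /(_ le_in) ->.
by rewrite g1 mulr0.
Qed.

(** The difference of the two sides vanishes at both ends and has zero second differences, since at
    [j] only the hat with its kink at [j.+1] contributes. *)
Lemma hat_decomposition (f : nat -> R) i :
    f 0%N = 0 -> f n = 0 -> (i <= n)%N ->
  f i = \sum_(k < n.-1) diff2 f k / n%:R * hat k.+1 i.
Proof.
move=> f0 fn le_in; apply/eqP; rewrite -subr_eq0; apply/eqP.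
pose s j := \sum_(k < n.-1) diff2 f k / n%:R * hat k.+1 j.
apply: (@diff2_eq0_eq0 (fun j => f j - s j)) le_in => [||j lt_jn].
- rewrite f0 /s big1 ?subr0 // => k _.
  by rewrite hat_le // mulr0 mulr0.
- rewrite fn /s big1 ?subr0 // => k _.
  by rewrite hat_ge ?subrr ?mulr0 //; have := ltn_ord k; lia.
have -> : diff2 (fun j => f j - s j) j = diff2 f j - diff2 s j.
  by rewrite /diff2; ring.
have -> : diff2 s j = \sum_(k < n.-1) diff2 f k / n%:R * diff2 (hat k.+1) j.
  rewrite /diff2 /s mulr_sumr -!sumrB; apply: eq_bigr => k _.
  by rewrite /diff2; ring.
have lt_jn1 : (j < n.-1)%N by lia.
rewrite (bigD1 (Ordinal lt_jn1)) //= big1 ?addr0 => [|k ne_kj].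
  rewrite diff2_hat eqxx mulr1 divfK ?subrr // pnatr_eq0; lia.
by rewrite diff2_hat eq_sym (negbTE (ne_kj : (k : nat) != j)) !mulr0.
Qed.

End HatDecomposition.

Section CardinalityBased.
Variables (R : realType) (T : finType) (y : {set T} -> R).
Hypothesis y_cb : cardinality_based y.

(** Initial segments of [enum T] serve as representatives of the cardinalities up to [#|T|]. *)
Definition card_profile (i : nat) : R := y [set x in take i (enum T)].

Lemma card_take_enum i : (i <= #|T|)%N -> #|[set x in take i (enum T)]| = i.
Proof.
move=> le_iT; rewrite cardsE (card_uniqP _) ?take_uniq ?enum_uniq //.
by rewrite size_takel // -cardE.
Qed.

Lemma card_profileE (S : {set T}) : y S = card_profile #|S|.
Proof. by apply: y_cb; rewrite card_take_enum ?max_card. Qed.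

(** Take [C] of size [i] and two distinct nodes outside it: adding either one gives two sets of size
    [i.+1] whose intersection is [C] and whose union has size [i.+2]. *)
Lemma card_profile_concave i :
  submodular y -> (i.+1 < #|T|)%N -> 0 <= diff2 card_profile i.
Proof.
move=> y_sub lt_iT; pose C := [set x in take i (enum T)].
have cC : #|C| = i by rewrite card_take_enum // ltnW // ltnW.
have /card_gt1P[u [v [uC vC ne_uv]]] : (1 < #|~: C|)%N.
  by have := cardsC C; lia.
rewrite !inE in uC vC.
have := y_sub (u |: C) (v |: C).
have -> : (u |: C) :&: (v |: C) = C.
  apply/setP => x; rewrite !inE; case: (x \in take _ _); rewrite ?orbT ?orbF //.
  by apply/negbTE/negP => /andP[/eqP -> /eqP uv]; rewrite uv eqxx in ne_uv.
have -> : (u |: C) :|: (v |: C) = u |: (v |: C).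
  by rewrite setUACA setUid setUA.
rewrite !card_profileE !cardsU1 !inE negb_or ne_uv uC vC cC /= !add1n /diff2.
by lra.
Qed.

Lemma submodular_gadget : asym_splitting y -> submodular y ->
  exists G : gadget R T, gadget_splitting G =1 y.
Proof.
move=> [_ yT y0] y_sub; set n := #|T|.
pose c (k : 'I_n.-1) : R := diff2 card_profile k / n%:R.
have c_ge0 k : 0 <= c k.
  rewrite divr_ge0 // card_profile_concave //.
  by rewrite -/n; have := ltn_ord k; lia.
pose a k : R := c k * (n%:R - k.+1%:R).
pose b k : R := c k * k.+1%:R.
have a_ge0 k : 0 <= a k.
  by rewrite mulr_ge0 // subr_ge0 ler_nat; have := ltn_ord k; lia.
have b_ge0 k : 0 <= b k by rewrite mulr_ge0.
exists (star_gadget T a_ge0 b_ge0) => S.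
rewrite star_gadget_splitting card_profileE.
rewrite (@hat_decomposition R n card_profile) ?max_card //; last 2 first.
- by rewrite -(cards0 T) -card_profileE.
- by rewrite /n -cardsT -card_profileE.
apply: eq_bigr => k _.
have -> : #|~: S|%:R = n%:R - #|S|%:R :> R by rewrite /n -(cardsC S) natrD addrC addKr.
(* As [c k] is nonnegative, it factors out of the minimum and leaves [hat k.+1]. *)
by rewrite -/(c k) /a /b -2!(mulrA (c k)) -minr_pMr.
Qed.

End CardinalityBased.

Theorem theorem4p8 (R : realType) (I : asym_cut_instance R)
  (I_cb : forall e, e \in hyperedges I -> cardinality_based (@splitting_fun R I e)) :
  graph_reducible I <->
  (forall e, e \in hyperedges I -> submodular (@splitting_fun R I e)).
Proof.
split=> [red e /red[G yG] A B|y_sub e eI].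
  by rewrite -!yG; exact: gadget_splitting_submodular.
exact: submodular_gadget (I_cb e eI) (splitting_funP eI) (y_sub e eI).
Qed.
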